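(* Consider the online Packing Scheduling Problem with an $m\times n$ constraint matrix $B=(b_{ij})$ with $b_{ij}>0$ for all $i,j$, and let $b_j=\min_i b_{ij}$, $B_j=\max_i b_{ij}$. Consider the algorithm that at every time $t$ selects, among pending jobs, a job $j$ maximizing $\delta_j/b_j$ and processes it at rate $x_j(t)=1/B_j$ (all other rates $0$). This algorithm is $\max_j\{B_j/b_j\}$-speed $1$-competitive for fractional weighted flow time $\sum_j\delta_j\int_{r_j}^\infty (t-r_j)x_j(t)\,dt$, and, for every $\epsilon>0$, $\max_j\{(1+\epsilon)B_j/b_j\}$-speed $\frac{1+\epsilon}{\epsilon}$-competitive for integral weighted flow time $\sum_j w_j(C_j-r_j)$.
   Context: Jobs $j=1,\dots,n$ arrive online with release time $r_j\ge0$, processing time $p_j>0$, weight $w_j>0$, density $\delta_j=w_j/p_j$. At each time $t$ the scheduler assigns rates $x_j(t)\ge0$ ($x_j(t)=0$ for $t<r_j$) subject to $\sum_j b_{ij}x_j(t)\le 1$ for every $i=1,\dots,m$; $C_j$ is the first time with $\int_{r_j}^{C_j}x_j=p_j$, and a job is pending if released but not completed. An online algorithm is $\alpha$-speed $\beta$-competitive if its cost is at most $\beta$ times the minimum cost over offline schedules satisfying $\sum_j b_{ij}x_j(t)\le 1/\alpha$ for all $i,t$. *)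

(* Defs.v *)
From HB Require Import structures.
From mathcomp Require Import all_boot all_order all_algebra.
From mathcomp Require Import all_classical all_reals all_analysis.

Set Implicit Arguments.
Unset Strict Implicit.
Unset Printing Implicit Defensive.

Import Order.TTheory GRing.Theory Num.Theory.
Import numFieldNormedType.Exports.

Local Open Scope classical_set_scope.
Local Open Scope ring_scope.

Record jobs (R : realType) (n : nat) := Jobs {
  release : 'I_n -> R;
  ptime : 'I_n -> R;
  weight : 'I_n -> R;
  release_ge0 : forall j, 0 <= release j;
  ptime_gt0 : forall j, 0 < ptime j;
  weight_gt0 : forall j, 0 < weight j }.

Definition density (R : realType) (n : nat) (J : jobs R n) (j : 'I_n) : R :=
  weight J j / ptime J j.

(* Column extrema; there is at least one row, and the neutral element of the
   iterated operation is itself an entry of the column. *)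
Definition colmin (R : realType) (m n : nat) (B : 'M[R]_(m.+1, n)) (j : 'I_n)
    : R :=
  \big[Num.min/B ord0 j]_(i < m.+1) B i j.

Definition colmax (R : realType) (m n : nat) (B : 'M[R]_(m.+1, n)) (j : 'I_n)
    : R :=
  \big[Num.max/B ord0 j]_(i < m.+1) B i j.

(* [x j t] is the rate of job [j] at time [t]. *)
Definition schedule (R : realType) (n : nat) := 'I_n -> R -> R.

Section Schedules.
Context {R : realType} {m n : nat}.
Variables (B : 'M[R]_(m.+1, n)) (J : jobs R n).
Implicit Types (x : schedule R n) (j : 'I_n) (t c : R).

Definition processed x j t : \bar R :=
  (\int[lebesgue_measure]_(s in `[release J j, t]) (x j s)%:E)%E.

(* The first time at which [j] has been processed by [ptime J j], and [+oo] if
   there is none. The infimum is attained whenever [x j] is nonnegative,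
   measurable and bounded, since [processed x j] is then continuous. *)
Definition completion x j : \bar R :=
  ereal_inf [set t%:E | t in
    [set t | release J j <= t /\ processed x j t = (ptime J j)%:E]].

Definition pending x j t : Prop :=
  release J j <= t /\ (t%:E < completion x j)%E.

(* Schedules with capacity [c] in every constraint that complete all jobs. *)
Definition feasible c x : Prop :=
  [/\ forall j, measurable_fun setT (x j),
      forall j t, 0 <= x j t,
      forall j t, t < release J j -> x j t = 0,
      forall i t, \sum_(j < n) B i j * x j t <= c
    & forall j, (completion x j < +oo)%E].

Definition fractional_flow_time x : \bar R :=
  (\sum_(j < n) (density J j)%:E *
    \int[lebesgue_measure]_(t in `[release J j, +oo[)
      ((t - release J j) * x j t)%:E)%E.

Definition integral_flow_time x : \bar R :=
  (\sum_(j < n) (weight J j)%:E * (completion x j - (release J j)%:E))%E.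

(* The schedules the algorithm may produce. Ties are broken arbitrarily,
   possibly differently at different times, provided that the resulting rates
   are measurable. The decision at time [t] only involves the jobs pending at
   [t], which makes the algorithm online. *)
Definition greedy x : Prop :=
  (forall j, measurable_fun setT (x j)) /\
  forall t,
    (exists j,
      [/\ pending x j t,
          forall k, pending x k t ->
            density J k / colmin B k <= density J j / colmin B j
        & forall k, x k t = if k == j then (colmax B j)^-1 else 0])
    \/ ((forall j, ~ pending x j t) /\ forall j, x j t = 0).

End Schedules.

(* [A J x] means that the algorithm [A], on the jobs [J], may produce the
   schedule [x]. The algorithm has to produce some schedule, and every schedule
   it produces has to be feasible at full capacity. The adversary has capacity
   [alpha^-1]. *)
Definition speed_competitive (R : realType) (m n : nat) (B : 'M[R]_(m.+1, n))
    (A : jobs R n -> schedule R n -> Prop)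
    (cost : jobs R n -> schedule R n -> \bar R) (alpha beta : R) : Prop :=
  forall J : jobs R n,
    (exists x, A J x) /\
    forall x, A J x ->
      feasible B J 1 x /\
      (cost J x <= beta%:E *
        ereal_inf [set cost J y | y in feasible B J alpha^-1])%E.

(* Main.v *)
(* Write kappa_j = delta_j / b_j for the priority of job j, and measure its
   work in units of b_j. While jobs of priority at least theta are pending, the
   algorithm works on them at a scaled rate of at least min_j b_j / B_j, whereas
   the scaled rates of the adversary sum to at most 1 / alpha. Fix t, and let s
   be the start of the interval up to t during which some job of priority at
   least theta has always been pending. Those released before s are completed at
   s; those released in [s, t], of total scaled volume N, have received at least
   (1 + e) (t - s) c work from the algorithm and at most (t - s) c from the
   adversary, with c = 1 / alpha and e = 0 or e = epsilon. Hence for e = 0 the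
   algorithm has less volume left above theta than the adversary has, and for
   e > 0 the adversary has at least N - N / (1 + e) left, while the jobs pending
   for the algorithm have total volume at most N. Summation by parts over theta
   turns these bounds into bounds on the density-weighted volumes at time t,
   and integrating over t gives the two costs. *)

Require Import Defs.
From HB Require Import structures.
From mathcomp Require Import all_boot all_order all_algebra.
From mathcomp Require Import all_classical all_reals all_analysis.
From mathcomp Require Import measurable_realfun lra.

Set Implicit Arguments.
Unset Strict Implicit.
Unset Printing Implicit Defensive.

Import Order.TTheory GRing.Theory Num.Theory.
Import numFieldNormedType.Exports.

Local Open Scope ring_scope.

(** * Work done by a bounded rate *)

Section Work.
Context {R : realType}.
Notation mu := (@lebesgue_measure R).

Definition bounded_rate (c : R) (z : R -> R) : Prop :=
  measurable_fun setT z /\ forall t, 0 <= z t <= c.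

(** Starting at time 0 gives all jobs the same origin, and half-open intervals glue without
    overlap. *)
Definition work (z : R -> R) (t : R) : R :=
  \int[mu]_(s in `[0, t[%classic) z s.

Lemma bounded_rate_integrable c z (I : interval R) (a b : R) :
  bounded_rate c z -> ([set` I] `<=` `[a, b])%classic ->
  mu.-integrable [set` I] (EFin \o z).
Proof.
move=> [mz zc] Iab; have m1 : measurable [set` I]%classic by [].
have m2 : measurable `[a, b]%classic by [].
apply: (integrableS (mu := mu) m2 m1 Iab).
apply: measurable_bounded_integrable => //.
- rewrite /= lebesgue_measure_itv /=.
  by case: ifP => // _; rewrite -EFinD ltry.
- exact: measurable_funTS.
- exists c; split; first exact: num_real.
  move=> y cy t _; have /andP[z0 zt] := zc t.
  by rewrite /= ger0_norm// (le_trans zt)// ltW.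
Qed.

Lemma integrable_co c z (a b : R) : bounded_rate c z ->
  mu.-integrable `[a, b[%classic (EFin \o z).
Proof.
move=> zc; apply: (bounded_rate_integrable (a := a) (b := b) zc).
by move=> t /=; rewrite !in_itv/= => /andP[-> /ltW ->].
Qed.

Lemma integral_co_fin c z (a b : R) : bounded_rate c z ->
  (\int[mu]_(s in `[a, b[) (z s)%:E)%E =
  (\int[mu]_(s in `[a, b[%classic) z s)%:E.
Proof.
move=> zc; rewrite fineK//.
by apply: integrable_fin_num => //; exact: integrable_co zc.
Qed.

Lemma workB c z s t : bounded_rate c z -> 0 <= s -> s <= t ->
  work z t - work z s = \int[mu]_(u in `[s, t[%classic) z u.
Proof.
move=> zc s0 st; rewrite /work.
rewrite (@itv_bndbnd_setU _ _ (BLeft 0) (BLeft s) (BLeft t)) ?bnd_simp//.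
rewrite Rintegral_setU//.
- by rewrite addrAC subrr add0r.
- rewrite -itv_bndbnd_setU ?bnd_simp//; exact: integrable_co zc.
- apply/disj_setPS => u [] /=; rewrite !in_itv/= => /andP[_ us] /andP[su _].
  by move: us; rewrite ltNge su.
Qed.

Lemma Rintegral_cst_co (a b c : R) : a <= b ->
  \int[mu]_(u in `[a, b[%classic) c = c * (b - a).
Proof.
move=> ab; rewrite Rintegral_cst//= lebesgue_measure_itv/= lte_fin.
by case: ltP => [//|ba]; rewrite (@le_anti _ _ a b) ?ab ?subrr.
Qed.

Lemma work_le0 z t : t <= 0 -> work z t = 0.
Proof.
by move=> t0; rewrite /work set_itv_ge ?Rintegral_set0// bnd_simp -leNgt.
Qed.

Lemma le_work c z s t : bounded_rate c z -> s <= t ->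
  work z s <= work z t <= work z s + c * (t - s).
Proof.
move=> zc; have [_ z0c] := zc.
have c0 : 0 <= c by have /andP[z0] := z0c 0; exact: le_trans.
(* Nothing is counted before time 0, so a negative [s] can be replaced by 0. *)
wlog s0 : s / 0 <= s => [hw st|st].
  have [s0|/ltW s0] := leP 0 s; first exact: hw.
  rewrite (work_le0 _ s0) add0r.
  have [t0|/ltW t0] := leP t 0.
    by rewrite work_le0// lexx mulr_ge0// subr_ge0.
  have /andP[h1 h2] := hw 0 (lexx 0) t0; move: h1 h2.
  rewrite (work_le0 _ (lexx 0)) add0r => -> /le_trans -> //.
  by rewrite ler_wpM2l// lerB.
apply/andP; split.
  rewrite -subr_ge0 (workB zc)//.
  by apply: Rintegral_ge0 => u _; case/andP: (z0c u).
rewrite -lerBlDl (workB zc)// -Rintegral_cst_co//; apply: le_Rintegral => //.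
- exact: integrable_co zc.
- by apply: (@integrable_co c) => //; split=> // u; rewrite lexx andbT.
- by move=> u _; case/andP: (z0c u).
Qed.

Lemma work_homo c z s t : bounded_rate c z -> s <= t ->
  work z s <= work z t.
Proof. by move=> zc st; case/andP: (le_work zc st). Qed.

Lemma work_eq c z s t : bounded_rate c z -> 0 <= s -> s <= t ->
  (forall u, s <= u < t -> z u = 0) -> work z t = work z s.
Proof.
move=> zc s0 st z0; apply/eqP; rewrite -subr_eq0 (workB zc)//.
rewrite (@eq_Rintegral _ _ _ _ _ (cst 0)).
  by rewrite Rintegral_cst_co// mul0r.
by move=> u; rewrite inE/= in_itv/= => /z0.
Qed.

Lemma work_continuous c z : bounded_rate c z -> continuous (work z).
Proof.
move=> zc; have [_ z0c] := zc.
have c0 : 0 <= c by have /andP[z0] := z0c 0; exact: le_trans.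
have lip a b : `|work z a - work z b| <= c * `|a - b|.
  wlog ab : a b / a <= b => [hw|].
    have [|/ltW] := leP a b; first exact: hw.
    by rewrite distrC (distrC a); exact: hw.
  have /andP[h1 h2] := le_work zc ab.
  by rewrite distrC (distrC a) !ger0_norm ?subr_ge0// lerBlDl.
move=> a; apply/cvgrPdist_lt => e e0.
(* [c] may be 0, so [c + 1] serves as the divisor. *)
have c1 : 0 < c + 1 by rewrite ltr_wpDl.
near=> b; rewrite (le_lt_trans (lip _ _))//.
rewrite (@le_lt_trans _ _ ((c + 1) * `|a - b|))// ?ler_wpM2r ?lerDl//.
rewrite mulrC -ltr_pdivlMr//.
near: b; apply: (@cvgr_dist_lt _ _ _ _ _ (fun b : R => b) a).
  exact: cvg_id.
exact: divr_gt0.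
Unshelve. all: by end_near. Qed.

Lemma work_IVT c z s t v : bounded_rate c z -> s <= t ->
  work z s <= v <= work z t ->
  exists2 u, s <= u <= t & work z u = v.
Proof.
move=> zc st /andP[vs vt].
have [||u us uv] := @IVT R (work z) s t v st.
- exact/continuous_subspaceT/work_continuous/zc.
- by rewrite ge_min le_max vs vt orbT.
- by exists u => //; move: us; rewrite in_itv.
Qed.

End Work.

(* Peels off the smallest positive value of [f], which is a multiple of the sum
   of [c] over an upper set, and recurses on the support. *)
Lemma ge0_sum_upper_sets (R : realFieldType) (I : finType) (f c : I -> R) :
  (forall i, 0 <= f i) ->
  (forall theta, 0 < theta -> 0 <= \sum_(i | theta <= f i) c i) ->
  0 <= \sum_i f i * c i.
Proof.
move: {2}#|_| (leqnn #|[pred i | 0 < f i]|) => N.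
elim: N f => [|N IHN] f cardf f_ge0 c_ge0.
  rewrite big1// => i _; suff -> : f i = 0 by rewrite mul0r.
  apply/eqP; move: (f_ge0 i); rewrite le_eqVlt => /predU1P[<-//|fi0].
  by move: cardf; rewrite leqn0 => /eqP/card0_eq/(_ i); rewrite inE fi0.
have [/existsP[i0 fi0]|/existsPn f0] := boolP [exists i, 0 < f i]; last first.
  apply: (IHN f) => //; rewrite eq_card0// => i.
  by apply/negbTE; rewrite inE f0.
have [i1 fi1 i1_min] := @arg_minP _ _ _ i0 (fun i => 0 < f i) f fi0.
pose mu := f i1; pose g i := if 0 < f i then f i - mu else 0.
have fE i : f i = g i + (if mu <= f i then mu else 0).
  rewrite /g; case: ifPn => [fi|]; first by rewrite i1_min// subrK.
  rewrite -leNgt => fi; rewrite add0r ifF; last first.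
    by apply/negbTE; rewrite -ltNge (le_lt_trans fi).
  by apply/eqP; rewrite eq_le fi f_ge0.
under eq_bigr do rewrite fE mulrDl.
rewrite big_split/= addr_ge0//; last first.
  rewrite (eq_bigr (fun i => if mu <= f i then mu * c i else 0)); last first.
    by move=> i _; case: ifP => _; rewrite ?mul0r.
  rewrite -big_mkcond/= -mulr_sumr mulr_ge0//; first exact: ltW.
  exact: c_ge0.
apply: IHN.
- rewrite -ltnS (leq_trans _ cardf)//; apply: proper_card.
  apply/properP; split; last exists i1.
  + apply/fintype.subsetP => i; rewrite !inE /g; case: ifP => //.
    by rewrite ltxx.
  + by rewrite inE.
  + by rewrite inE /g fi1 subrr ltxx.
- by move=> i; rewrite /g; case: ifPn => // fi; rewrite subr_ge0 i1_min.
(* At a positive level [theta], the upper set of [g] is the upper set of [f] at level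
   [theta + mu]. *)
- move=> theta theta0; rewrite (eq_bigl (fun i => theta + mu <= f i)).
    by apply: c_ge0; rewrite addr_gt0.
  move=> i; rewrite /g; case: ifPn => [fi|]; first by rewrite lerBrDr.
  rewrite -leNgt => fi; rewrite leNgt theta0/=; apply/esym/negbTE.
  by rewrite -ltNge (le_lt_trans fi)// addr_gt0.
Qed.

(** Used with the priorities as [f]: bounds that hold above every priority threshold combine into
    one bound on the priority-weighted sums. *)
Lemma le_sum_upper_sets (R : realFieldType) (I : finType) (f u v : I -> R) :
  (forall i, 0 <= f i) ->
  (forall theta, \sum_(i | theta <= f i) u i <= \sum_(i | theta <= f i) v i) ->
  \sum_i f i * u i <= \sum_i f i * v i.
Proof.
move=> f0 uv; rewrite -subr_ge0 -sumrB.
under eq_bigr do rewrite -mulrBr.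
apply: ge0_sum_upper_sets => // theta _.
by rewrite sumrB subr_ge0.
Qed.

Section ColumnExtrema.
Context {R : realType} {m n : nat}.
Variable (B : 'M[R]_(m.+1, n)).
Hypothesis B_gt0 : forall i j, 0 < B i j.

Lemma colmin_gt0 j : 0 < colmin B j.
Proof.
by rewrite /colmin; elim/big_ind : _ => // x y x0 y0; rewrite lt_min x0.
Qed.

Lemma colmin_le i j : colmin B j <= B i j.
Proof. by rewrite /colmin (bigD1 i)//= ge_min lexx. Qed.

Lemma colmax_ge i j : B i j <= colmax B j.
Proof. by rewrite /colmax (bigD1 i)//= le_max lexx. Qed.

Lemma colmax_gt0 j : 0 < colmax B j.
Proof. exact: lt_le_trans (B_gt0 ord0 j) (colmax_ge ord0 j). Qed.

End ColumnExtrema.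

(** * Completion times under bounded rates *)

Section Completion.
Context {R : realType} {n : nat} (J : jobs R n).
Implicit Types (x : schedule R n) (j : 'I_n).
Notation F x j := (work (x j)).

(** The common ground of greedy schedules, of the adversary's schedules and of the one-job schedule
    built in [fill_idle_time]. *)
Definition rate_bounded c x : Prop :=
  (forall j, bounded_rate c (x j)) /\ forall j t, t < release J j -> x j t = 0.

Lemma work_release c x j t : rate_bounded c x -> t <= release J j ->
  F x j t = 0.
Proof.
move=> [xc xr] tr; have [t0|/ltW t0] := leP t 0; first exact: work_le0.
rewrite (work_eq (xc j) (lexx 0) t0) ?(work_le0 _ (lexx 0))// => u /andP[_ ut].
by apply: xr; exact: lt_le_trans tr.
Qed.

(** The right endpoint has measure 0, and the rate vanishes before the release, so integrating from
    0 over a half-open interval gives the same value. *)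
Lemma processedE c x j t : rate_bounded c x ->
  processed J x j t = (F x j t)%:E.
Proof.
move=> xc; have rj := release_ge0 J j.
have /measurable_EFinP mx := (xc.1 j).1.
rewrite /processed -integral_itv_bndo_bndc; last exact: measurable_funTS.
rewrite (integral_co_fin _ _ ((xc).1 j)); congr EFin.
have [tr|/ltW tr] := leP t (release J j).
  by rewrite (work_release xc)// set_itv_ge ?Rintegral_set0// bnd_simp -leNgt.
by rewrite -(workB (xc.1 j))// (work_release xc (lexx _)) subr0.
Qed.

Lemma completion_le c x j t : rate_bounded c x -> release J j <= t ->
  F x j t = ptime J j -> (completion J x j <= t%:E)%E.
Proof.
move=> xc rt Ft; apply: ereal_inf_lbound; exists t => //; split => //.
by rewrite (processedE _ _ xc) Ft.
Qed.

Lemma completion_ge_release x j : ((release J j)%:E <= completion J x j)%E.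
Proof. by apply: le_ereal_inf_tmp => _ [t [rt _] <-]; rewrite lee_fin. Qed.

Lemma completion_lt_ex c x j a : rate_bounded c x ->
  (completion J x j < a)%E ->
  exists t, [/\ release J j <= t, (t%:E < a)%E & F x j t = ptime J j].
Proof.
move=> xc /ereal_inf_lt[_ [t [rt pt] <-] ta]; exists t; split => //.
by move: pt; rewrite (processedE _ _ xc) => -[].
Qed.

Lemma completion_fin x j : (completion J x j < +oo)%E ->
  exists2 C, release J j <= C & completion J x j = C%:E.
Proof.
move=> Cy; have rC := completion_ge_release x j.
have /fineK CE : completion J x j \is a fin_num.
  by rewrite fin_numElt (lt_le_trans (ltNyr _) rC).
by exists (fine (completion J x j)); rewrite -?lee_fin CE.
Qed.

(** The infimum is attained: arbitrarily soon after [t] the work equals [ptime J j], and by the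
    Lipschitz bound of [le_work] the work at [t] falls short of it by arbitrarily little. *)
Lemma work_completion c x j t : rate_bounded c x ->
  completion J x j = t%:E -> F x j t = ptime J j.
Proof.
move=> xc Ct; have c0 : 0 <= c.
  by have [_ /(_ 0)/andP[z0]] := xc.1 j; exact: le_trans.
have rt : release J j <= t by rewrite -lee_fin -Ct completion_ge_release.
have near_t e : 0 < e -> exists s, [/\ t <= s, s < t + e & F x j s = ptime J j].
  move=> e0; have := @completion_lt_ex c x j (t + e)%:E xc.
  rewrite Ct lte_fin ltrDl => /(_ e0)[s [rs st Fs]]; exists s; split => //.
  by rewrite -lee_fin -Ct (completion_le xc).
apply/eqP; rewrite eq_le; apply/andP; split.
  by have [s [ts _ <-]] := near_t 1 ltr01; exact: work_homo (xc.1 j) ts.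
apply/ler_addgt0Pr => e e0.
have [|s [ts st <-]] := near_t (e / (c + 1)).
  by rewrite divr_gt0// ltr_wpDl.
have /andP[_ /le_trans->//] := le_work (xc.1 j) ts.
rewrite lerD2l (@le_trans _ _ ((c + 1) * (e / (c + 1))))//.
  by rewrite ler_pM ?subr_ge0 ?lerDl// lerBlDl ltW.
by rewrite mulrC divfK// gt_eqF// ltr_wpDl.
Qed.

End Completion.

(** * Greedy schedules *)

Section WorkSum.
Context {R : realType} {I : finType}.
Notation mu := (@lebesgue_measure R).
Variables (P : pred I) (b : I -> R) (z : I -> R -> R) (c : R).
Hypothesis zc : forall i, bounded_rate c (z i).

(** Both claims go through one induction, since additivity of the integral uses the integrability of
    the remaining sum. *)
Lemma Rintegral_rate_sum s t :
  mu.-integrable `[s, t[%classic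
    (EFin \o (fun u => \sum_(i | P i) b i * z i u)) /\
  \int[mu]_(u in `[s, t[%classic) (\sum_(i | P i) b i * z i u) =
    \sum_(i | P i) b i * \int[mu]_(u in `[s, t[%classic) z i u.
Proof.
elim: (index_enum I) => [|i r [IHi IHe]].
  have -> : (fun u => \sum_(i <- [::] | P i) b i * z i u) = cst 0.
    by apply/funext => u; rewrite big_nil.
  rewrite big_nil; split; last by rewrite Rintegral_cst//= mul0r.
  exact: integrable0.
have -> : (fun u => \sum_(i <- i :: r | P i) b i * z i u) =
    if P i then (fun u => b i * z i u + \sum_(i <- r | P i) b i * z i u)
    else (fun u => \sum_(i <- r | P i) b i * z i u).
  by case: ifPn => Pi; apply/funext => u; rewrite big_cons ?Pi ?(negbTE Pi).
rewrite big_cons; case: ifP => // Pi.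
have zi : mu.-integrable `[s, t[%classic (EFin \o z i) by exact: integrable_co.
have bzi : mu.-integrable `[s, t[%classic (EFin \o (fun u => b i * z i u)).
  exact: (integrableZl (mu := mu) _ (b i) zi).
split; first exact: (integrableD (mu := mu) _ bzi IHi).
by rewrite (RintegralD (mu := mu) _ bzi IHi)// IHe RintegralZl.
Qed.

Lemma sum_workB s t : 0 <= s -> s <= t ->
  \sum_(i | P i) b i * (work (z i) t - work (z i) s) =
  \int[mu]_(u in `[s, t[%classic) (\sum_(i | P i) b i * z i u).
Proof.
move=> s0 st; rewrite (Rintegral_rate_sum s t).2.
by apply: eq_bigr => i _; rewrite (workB (zc i)).
Qed.

Lemma integrable_cst_co (k s t : R) :
  mu.-integrable `[s, t[%classic (EFin \o cst k).
Proof.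
apply/integrableP; split; first exact/measurable_EFinP.
rewrite /= integral_cst//= lebesgue_measure_itv/=; case: ifP => _.
  by rewrite -EFinB -EFinM ltry.
by rewrite mule0.
Qed.

Lemma le_sum_work s t k : 0 <= s -> s <= t ->
  (forall u, s <= u < t -> \sum_(i | P i) b i * z i u <= k) ->
  \sum_(i | P i) b i * (work (z i) t - work (z i) s) <= k * (t - s).
Proof.
move=> s0 st zk; rewrite sum_workB// -Rintegral_cst_co//.
apply: le_Rintegral => //; first exact: (Rintegral_rate_sum s t).1.
exact: integrable_cst_co.
Qed.

Lemma ge_sum_work s t k : 0 <= s -> s <= t ->
  (forall u, s <= u < t -> k <= \sum_(i | P i) b i * z i u) ->
  k * (t - s) <= \sum_(i | P i) b i * (work (z i) t - work (z i) s).
Proof.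
move=> s0 st zk; rewrite sum_workB// -Rintegral_cst_co//.
apply: le_Rintegral => //; first exact: integrable_cst_co.
exact: (Rintegral_rate_sum s t).1.
Qed.

End WorkSum.

Section Greedy.
Context {R : realType} {m n : nat}.
Variables (B : 'M[R]_(m.+1, n)) (J : jobs R n).
Hypothesis B_gt0 : forall i j, 0 < B i j.
Implicit Types (x y : schedule R n) (j k : 'I_n).
Notation F x j := (work (x j)).

Definition priority j : R := density J j / colmin B j.

Variable x : schedule R n.
Hypothesis xg : greedy B J x.

Lemma greedy_pending j t : x j t != 0 -> pending J x j t.
Proof.
have [[k [pk _ ->]]|[_ ->]] := xg.2 t; last by rewrite eqxx.
by case: ifPn => [/eqP->//|_]; rewrite eqxx.
Qed.

Lemma greedy_idle j t : ~ pending J x j t -> x j t = 0.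
Proof. by move=> pj; apply/eqP/negPn/negP => /greedy_pending. Qed.

Lemma greedy_rate_ge0 j t : 0 <= x j t.
Proof.
have [[k [pk _ ->]]|[_ ->//]] := xg.2 t.
by case: ifPn => // _; rewrite invr_ge0 ltW// colmax_gt0.
Qed.

(** The sum over all jobs is a crude bound that serves every job at once. *)
Lemma greedy_rate_bounded : rate_bounded J (\sum_j (colmax B j)^-1) x.
Proof.
have B0 j : 0 <= (colmax B j)^-1 by rewrite invr_ge0 ltW// colmax_gt0.
split=> [j|j t tr]; last first.
  by apply: greedy_idle => -[]; rewrite leNgt tr.
split=> [|t]; first exact: xg.1.
rewrite greedy_rate_ge0/=.
have [[k [pk _ ->]]|[_ ->]] := xg.2 t; last exact: sumr_ge0.
case: ifP => _; last exact: sumr_ge0.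
by rewrite (bigD1 k)//= lerDl sumr_ge0.
Qed.

(** Work beyond [ptime J j] would pass through that value at some time [u]; from [u] on the job is
    no longer pending, so its rate is 0. *)
Lemma greedy_work_le j t : F x j t <= ptime J j.
Proof.
have xc := greedy_rate_bounded; have p0 := ptime_gt0 J j.
rewrite leNgt; apply/negP => pF; have rt : release J j <= t.
  have [//|/ltW tr] := leP (release J j) t.
  by move: pF; rewrite (work_release xc tr) ltNge (ltW p0).
have [|u /andP[ru ut] Fu] := work_IVT (v := ptime J j) (xc.1 j) rt.
  by rewrite (work_release xc (lexx _)) !ltW.
have Cu := completion_le xc ru Fu.
have u0 : 0 <= u := le_trans (release_ge0 J j) ru.
move: pF; rewrite (work_eq (xc.1 j) u0 ut) ?Fu ?ltxx// => v /andP[uv _].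
apply: greedy_idle => -[_]; rewrite ltNge => /negP; apply.
by rewrite (le_trans Cu)// lee_fin.
Qed.

Lemma greedy_work_done j t : release J j <= t -> ~ pending J x j t ->
  F x j t = ptime J j.
Proof.
move=> rt npt; have xc := greedy_rate_bounded.
have Ct : (completion J x j <= t%:E)%E.
  by rewrite leNgt; apply/negP => tC; apply: npt.
have [C _ CE] := completion_fin (le_lt_trans Ct (ltry t)).
have FC := work_completion xc CE.
apply/le_anti; rewrite greedy_work_le/= -{1}FC; apply: work_homo (xc.1 j) _.
by rewrite -lee_fin -CE.
Qed.

Lemma greedy_capacity i t : \sum_j B i j * x j t <= 1.
Proof.
have [[k [_ _ xk]]|[_ x0]] := xg.2 t; last first.
  by rewrite big1// => j _; rewrite x0 mulr0.
rewrite (bigD1 k)//= xk eqxx big1 ?addr0; last first.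
  by move=> j /negbTE jk; rewrite xk jk mulr0.
by rewrite ler_pdivrMr ?colmax_gt0// mul1r colmax_ge.
Qed.

(** If [j] stayed pending forever, some job would always be running from its release on, and the
    work measured in units of [colmax B] would grow at rate at least 1. It would exceed the total
    volume [L] after time [L + 1]. *)
Lemma greedy_completes j : (completion J x j < +oo)%E.
Proof.
have xc := greedy_rate_bounded.
rewrite ltNge leye_eq; apply/negP => /eqP Cy.
pose L := \sum_k colmax B k * ptime J k.
have B0 k : 0 <= colmax B k by rewrite ltW// colmax_gt0.
have L0 : 0 <= L by apply: sumr_ge0 => k _; rewrite mulr_ge0// ltW// ptime_gt0.
have r0 := release_ge0 J j.
have : 1 * ((release J j + (L + 1)) - release J j) <= L.
  have xck := xc.1.
  apply: (le_trans (ge_sum_work (P := xpredT) (b := colmax B) xck r0 _ _)).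
  - by rewrite lerDl addr_ge0.
  - move=> u /andP[ru _].
    have [[k [_ _ xk]]|[nop _]] := xg.2 u; last first.
      by case: (nop j); split => //; rewrite Cy ltry.
    rewrite (bigD1 k)//= xk eqxx mulfV ?gt_eqF ?colmax_gt0// lerDl sumr_ge0//.
    by move=> i _; rewrite mulr_ge0// greedy_rate_ge0.
  - apply: ler_sum => k _; rewrite ler_wpM2l// lerBlDr.
    rewrite (le_trans (greedy_work_le _ _))//.
    rewrite lerDl; apply: Rintegral_ge0 => u _; exact: greedy_rate_ge0.
by rewrite mul1r addrAC subrr add0r gerDl ler10.
Qed.

Lemma greedy_feasible : feasible B J 1 x.
Proof.
have xc := greedy_rate_bounded; split.
- exact: xg.1.
- exact: greedy_rate_ge0.
- exact: xc.2.
- exact: greedy_capacity.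
- exact: greedy_completes.
Qed.

(** The set [D] consists of the jobs of priority at least [theta] released during the busy period
    that contains [t]. The parameter [e] covers both costs: 0 for the fractional one, epsilon for
    the integral one. *)
Lemma greedy_domination y (cy c e theta t : R) : rate_bounded J cy y ->
  (forall j u, 0 <= y j u) ->
  (forall u, \sum_j colmin B j * y j u <= c) -> 0 <= 1 + e ->
  (forall j, (1 + e) * c <= colmin B j / colmax B j) ->
  exists D : {set 'I_n},
    [/\ forall j, j \in D -> theta <= priority j /\ release J j <= t,
        forall j, theta <= priority j -> release J j <= t -> j \notin D ->
          ~ pending J x j t
      & (1 + e) * (\sum_(j in D) colmin B j * F y j t) <=
        \sum_(j in D) colmin B j * F x j t].
Proof.
move=> yc y0 ycap e0 ce; have xc := greedy_rate_bounded.
have b0 j : 0 <= colmin B j by rewrite ltW// colmin_gt0.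
(* The release of [k] opens an interval up to [t] throughout which some job of priority at least
   [theta] is pending. *)
pose busy_from k := theta <= priority k /\ release J k <= t /\
  forall u, release J k <= u <= t ->
    exists j, theta <= priority j /\ pending J x j u.
have pend_busy j : theta <= priority j -> pending J x j t -> busy_from j.
  move=> thj [rj jC]; split => //; split => // u /andP[ru ut]; exists j.
  by split => //; split => //; apply: le_lt_trans jC; rewrite lee_fin.
have [[k0 bk0]|nobusy] := pselect (exists k, busy_from k); last first.
  (* Here no job of priority at least [theta] is pending at [t], so the empty set will do. *)
  exists finset.set0; split => [j|j thj rj _ pj|].
  - by rewrite inE.
  - by apply: nobusy; exists j; exact: pend_busy.
  - by rewrite !big_set0 mulr0.
have [k /asboolP[thk [rk bk]] kmin] :=
  @arg_minP _ _ _ k0 (fun k => `[< busy_from k >]) (release J) (asboolT bk0).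
(* The set of times at which a job of priority at least [theta] is pending is a
   finite union of intervals starting at release times, so the busy period
   containing [t] starts at such a time [s]. *)
set s := release J k in rk bk kmin.
have s0 : 0 <= s by exact: release_ge0.
pose D := [set j | (theta <= priority j) && (s <= release J j <= t)].
(* A job released before [s] and pending at [s] or at [t] would extend the busy period back to its
   own release, against the minimality of [s]. *)
have early j : theta <= priority j -> release J j < s ->
    ~ pending J x j s /\ ~ pending J x j t.
  move=> thj rjs; split => pj; last first.
    by move: rjs; rewrite ltNge kmin//; apply/asboolP/pend_busy.
  move: rjs; rewrite ltNge kmin//; apply/asboolP; split => //; split.
    exact: le_trans pj.1 rk.
  move=> u /andP[ru ut]; have [su|/ltW us] := leP s u.
    by apply: bk; rewrite su.
  exists j; split => //; split => //; apply: le_lt_trans pj.2.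
  by rewrite lee_fin.
(* Jobs released before [s] are complete at [s] and gain nothing; jobs released after [t] have
   received nothing yet. Only [D] contributes, and its work starts after [s]. *)
have xD : \sum_(j | theta <= priority j) colmin B j * (F x j t - F x j s) =
    \sum_(j in D) colmin B j * F x j t.
  rewrite big_mkcond [RHS]big_mkcond; apply: eq_bigr => j _.
  rewrite inE; case: ifPn => //= thj.
  have [rjs|srj] := ltP (release J j) s.
    have [ps pt] := early j thj rjs.
    rewrite /= !greedy_work_done ?subrr ?mulr0//; first exact: ltW.
    exact: le_trans (ltW rjs) rk.
  rewrite /= (work_release xc srj) subr0; case: leP => // /ltW tr.
  by rewrite (work_release xc tr) mulr0.
have yD : \sum_(j in D) colmin B j * (F y j t - F y j s) =
    \sum_(j in D) colmin B j * F y j t.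
  apply: eq_bigr => j; rewrite inE => /andP[_ /andP[srj _]].
  by rewrite (work_release yc srj) subr0.
exists D; split => [j|j thj rj|].
- by rewrite inE => /andP[? /andP[]].
- by rewrite inE thj rj andbT/= -ltNge => rjs; exact: (early j thj rjs).2.
(* The two amounts of work are separated by [(1 + e) * (c * (t - s))]. *)
rewrite -xD -yD (@le_trans _ _ ((1 + e) * (c * (t - s))))//.
  rewrite ler_wpM2l//; apply: le_sum_work => //; first exact: yc.1.
  move=> u _; apply: le_trans (ycap u).
  rewrite big_mkcond/=; apply: ler_sum => j _.
  by case: ifP => // _; rewrite mulr_ge0.
rewrite mulrA; apply: ge_sum_work => //; first exact: xc.1.
(* The running job [i] has priority at least that of the pending job [j], hence at least [theta], so
   its scaled rate is counted in the sum. *)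
move=> u /andP[su ut]; have [|j [thj pj]] := bk u; first by rewrite su ltW.
have [[i [_ imax xi]]|[nop _]] := xg.2 u; last by case: (nop j).
rewrite (bigD1 i)/=; last exact: le_trans thj (imax _ pj).
rewrite xi eqxx (le_trans (ce i))// lerDl sumr_ge0// => l _.
by rewrite mulr_ge0// greedy_rate_ge0.
Qed.

End Greedy.

(** * Existence of greedy schedules *)

Section Existence.
Context {R : realType} {m n : nat}.
Variables (B : 'M[R]_(m.+1, n)) (J : jobs R n).
Hypothesis B_gt0 : forall i j, 0 < B i j.
Implicit Types (x : schedule R n) (j k : 'I_n).
Local Open Scope classical_set_scope.

(** Whether [j] is pending depends on its own rate only, which allows schedules to be assembled job
    by job. *)
Lemma eq_pending x x' j t : x j = x' j -> pending J x j t = pending J x' j t.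
Proof. by rewrite /pending /completion /processed => ->. Qed.

(* [U] is the time taken by jobs of higher priority: whether [j] is pending does
   not depend on the jobs of lower priority, so a greedy schedule is built by
   adding the jobs one by one in order of priority. *)
Lemma fill_idle_time (U : set R) j (beta : R) : measurable U -> 0 < beta ->
  exists z : R -> R, [/\ measurable_fun setT z,
    forall t, U t -> z t = 0
    & forall x t, x j = z -> ~ U t ->
        (pending J x j t -> z t = beta) /\ (~ pending J x j t -> z t = 0)].
Proof.
move=> mU beta0; set r := release J j; set p := ptime J j.
have p0 : 0 < p by exact: ptime_gt0.
(* [g] is the rate that [j] would have if it were never completed; [z] below cuts it off once its
   work reaches [p]. *)
pose g : R -> R := fun u => beta * \1_(~` U `&` `[r, +oo[) u.
have g01 u : 0 <= g u <= beta.
  rewrite /g indicE; case: (u \in _); rewrite ?mulr1 ?mulr0 lexx (ltW beta0)//.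
have gc : bounded_rate beta g.
  split => //; apply: measurable_funM => //; apply: measurable_indic.
  by apply: measurableI => //; exact: measurableC.
pose P := [set t | r <= t /\ work g t < p].
have mP : measurable P.
  apply: is_interval_measurable => a b [ra _] [_ Gb] u /andP[au ub].
  by split; [exact: le_trans au | exact: le_lt_trans (work_homo gc ub) Gb].
pose z u := g u * \1_P u.
have zg u : P u -> z u = g u by move=> Pu; rewrite /z indicE mem_set// mulr1.
have z0 u : ~ P u -> z u = 0 by move=> Pu; rewrite /z indicE memNset// mulr0.
have g0 u : u < r -> g u = 0.
  move=> ur; rewrite /g indicE memNset ?mulr0// => -[_] /=.
  by rewrite in_itv/= andbT leNgt ur.
have z_lt u : u < r -> z u = 0 by move=> ur; rewrite /z g0 ?mul0r.
have zc : bounded_rate beta z.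
  split; first by apply: measurable_funM; [exact: gc.1|exact: measurable_indic].
  move=> u; have [Pu|nPu] := pselect (P u); first by rewrite zg.
  by rewrite z0// lexx ltW.
(* A schedule running [j] alone, to which the facts about completion times apply. *)
pose y : schedule R n := fun k => if k == j then z else cst 0.
have yj : y j = z by rewrite /y eqxx.
have yc : rate_bounded J beta y.
  split => [k|k t tk]; rewrite /y; last first.
    by case: eqP => // kj; rewrite z_lt// /r -kj.
  by case: ifP => // _; split => // t; rewrite lexx ltW.
have workP t : P t -> work z t = work g t.
  move=> [rt Gt]; apply: eq_Rintegral => u.
  rewrite inE/= in_itv/= => /andP[_ ut].
  have [ru|ur] := leP r u; last by rewrite z_lt// g0.
  by rewrite zg//; split => //; exact: le_lt_trans (work_homo gc (ltW ut)) Gt.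
(* [P] is defined through [g], whereas being pending refers to [z] itself. Their equivalence shows
   that [z] obeys the greedy rule without circularity. *)
have pendP t : pending J y j t <-> P t.
  split=> [[rt tC]|Pt].
    split => //; rewrite ltNge; apply/negP => pG.
    move: tC; rewrite ltNge => /negP; apply.
    (* [work g] may stay equal to [p] before time [t], but where it is below [p]
       it agrees with [work z]. *)
    have pz : p <= work z t.
      apply/ler_addgt0Pr => e e0; have [pe|ep] := leP p e.
        rewrite (le_trans pe)// lerDr; apply: Rintegral_ge0 => u _.
        by case/andP: (zc.2 u).
      have [|u /andP[ru ut] Gu] := work_IVT (v := p - e) gc rt.
        have -> : work g r = 0.
          have := work_release (x := fun k => if k == j then g else cst 0)
            (c := beta) (J := J) (j := j) (t := r).
          rewrite eqxx; apply => //; split => [k|k v vk]; case: eqP => // kj.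
            by split => // v; rewrite lexx ltW.
          by rewrite g0// /r -kj.
        by rewrite subr_ge0 (ltW ep)/= (le_trans _ pG)// gerBl ltW.
      rewrite -lerBlDr -Gu -workP; first exact: work_homo zc ut.
      by split => //; rewrite Gu gtrBl.
    have [|u /andP[ru ut] zu] := work_IVT (v := p) zc rt.
      by rewrite pz -yj (work_release yc (lexx _)) ltW.
    by rewrite (le_trans (completion_le yc ru _)) ?lee_fin// yj.
  have [rt Gt] := Pt; split => //; rewrite ltNge; apply/negP => Ct.
  have [C _ CE] := completion_fin (le_lt_trans Ct (ltry t)).
  move: Ct; rewrite CE lee_fin => Ct.
  have := work_completion yc CE; rewrite yj => FC.
  by have := work_homo zc Ct; rewrite FC workP// leNgt Gt.
exists z; split => [|t Ut|x t xz nUt].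
- exact: zc.1.
- by rewrite /z /g indicE memNset ?mulr0 ?mul0r// => -[].
- rewrite (@eq_pending x y) ?xz ?yj//; split => [/pendP[rt Gt]|nP]; last first.
    by apply: z0 => /pendP.
  rewrite zg// /g indicE mem_set ?mulr1//; split => //=.
  by rewrite in_itv/= rt.
Qed.

Lemma greedy_exists : exists x, greedy B J x.
Proof.
pose prio := priority B J; pose le_prio j k := prio k <= prio j.
(* The greedy rule restricted to the jobs of [s]; all other jobs have rate 0. *)
pose greedy_on (s : seq 'I_n) x := (forall j, measurable_fun setT (x j)) /\
  forall t, (exists j,
    [/\ j \in s, pending J x j t,
        forall k, k \in s -> pending J x k t -> prio k <= prio j
      & forall k, x k t = if k == j then (colmax B j)^-1 else 0])
  \/ ((forall j, j \in s -> ~ pending J x j t) /\ forall j, x j t = 0).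
suff [x [mx xs]] : exists x, greedy_on (sort le_prio (enum 'I_n)) x.
  have ins j : j \in sort le_prio (enum 'I_n) by rewrite mem_sort mem_enum.
  exists x; split => // t.
  have [[j [_ pj jmax xj]]|[nop x0]] := xs t; [left|right]; last first.
    by split => // j; exact: nop.
  by exists j; split => // k; exact: jmax.
have : uniq (sort le_prio (enum 'I_n)) by rewrite sort_uniq enum_uniq.
have : pairwise le_prio (sort le_prio (enum 'I_n)).
  rewrite -sorted_pairwise; last by move=> a b c ba ca; exact: le_trans ca ba.
  by apply: sort_sorted => a b; exact: le_total.
(* The list is sorted by decreasing priority, so the appended job [j] ranks below or level with all
   earlier ones. *)
elim/last_ind: (sort _ _) => [_ _|s j IHs].
  by exists (fun _ => cst 0); split => // t; right.
rewrite pairwise_rcons rcons_uniq => /andP[/allP jmin ps] /andP[js us].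
have [x [mx xs]] := IHs ps us.
(* The times at which the schedule for [s] is busy; there it is kept unchanged, and [j] is run only
   outside [U]. *)
pose U := \bigcup_(k in [set: 'I_n]) (x k @^-1` [set~ 0]).
have mU : measurable U.
  apply: fin_bigcup_measurable => // k _; rewrite -[X in measurable X]setTI.
  by apply: mx => //; exact: measurableC.
have beta0 : 0 < (colmax B j)^-1 by rewrite invr_gt0 colmax_gt0.
have [z [mz zU zN]] := fill_idle_time j mU beta0.
pose x' : schedule R n := fun k => if k == j then z else x k.
have x'j : x' j = z by rewrite /x' eqxx.
have x'k k : k \in s -> x' k = x k.
  by move=> ks; rewrite /x' ifN//; apply: contraNneq js => <-.
exists x'; split => [k|t]; first by rewrite /x'; case: ifP.
have [[k [ks pk kmax xk]]|[nop x0]] := xs t.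
  have Ut : U t.
    by exists k => //=; apply/eqP; rewrite xk eqxx gt_eqF// invr_gt0 colmax_gt0.
  have x't l : x' l t = x l t.
    rewrite /x'; case: eqP => // ->; rewrite zU// xk ifN//.
    by apply: contraNneq js => ->.
  left; exists k; split.
  - by rewrite mem_rcons inE ks orbT.
  - by rewrite (eq_pending _ (x'k _ ks)).
  - move=> l; rewrite mem_rcons inE => /predU1P[-> _|ls]; first exact: jmin.
    by rewrite (eq_pending _ (x'k _ ls)); exact: kmax.
  - by move=> l; rewrite x't.
have nUt : ~ U t by move=> [k _]; apply; exact: x0.
have [zp zn] := zN x' t x'j nUt.
have [pj|npj] := pselect (pending J x' j t); [left|right].
  exists j; split => // [|k|k]; first by rewrite mem_rcons mem_head.
    rewrite mem_rcons inE => /predU1P[->//|ks].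
    by rewrite (eq_pending _ (x'k _ ks)) => /nop.
  by rewrite /x'; case: ifP => // _; rewrite zp.
split => [k|k].
  rewrite mem_rcons inE => /predU1P[->//|ks].
  by rewrite (eq_pending _ (x'k _ ks)); exact: nop.
by rewrite /x'; case: ifP => // _; rewrite zn.
Qed.

End Existence.

(** * Costs as integrals over time *)

Section TimeIntegrals.
Context {R : realType}.
Notation mu := (@lebesgue_measure R).
Local Open Scope classical_set_scope.

(** Since [t - r] is the length of the interval from [r] to [t], this is Tonelli's theorem on the
    region where [r <= s <= t], with points written as [(t, s)]. It turns fractional flow time into
    an integral over time of the processing still to come. *)
Lemma integral_tail (z : R -> R) (r : R) : measurable_fun setT z ->
  (forall t, 0 <= z t) ->
  (\int[mu]_(t in `[r, +oo[) ((t - r) * z t)%:E =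
   \int[mu]_(s in `[r, +oo[) \int[mu]_(t in `[s, +oo[) (z t)%:E)%E.
Proof.
move=> mz z0; pose S := [set v : R * R | r <= v.2 <= v.1].
have mS : measurable S.
  have -> : S = [set v : R * R | r <= v.2] `&` [set v : R * R | v.2 <= v.1].
    by apply/seteqP; split => [v /andP[]//|v [/= ? ?]]; exact/andP.
  apply: measurableI.
    rewrite -[X in measurable X]setTI.
    exact: (measurable_fun_ler (f := cst r) (g := @snd R R)).
  rewrite -[X in measurable X]setTI.
  exact: (measurable_fun_ler (f := @snd R R) (g := @fst R R)).
pose f v : \bar R := (z v.1 * \1_S v)%:E.
have mf : measurable_fun setT f.
  apply/measurable_EFinP; apply: measurable_funM; last exact: measurable_indic.
  exact: measurableT_comp.
have f0 v : (0 <= f v)%E by rewrite lee_fin mulr_ge0// indicE.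
have S1 t s : f (t, s) = (z t * \1_(`[r, t]) s)%:E.
  by rewrite /f !indicE /=; congr (_ * _%:R)%:E; congr nat_of_bool;
    apply/idP/idP; rewrite !inE/= in_itv.
have S2 t s : r <= s -> f (t, s) = (z t * \1_(`[s, +oo[) t)%:E.
  move=> rs; rewrite /f !indicE /=; congr (_ * _%:R)%:E; congr nat_of_bool;
    apply/idP/idP; rewrite !inE/= in_itv/= andbT => H; last by rewrite /S/= rs.
  by case/andP: H.
transitivity (\int[mu]_t \int[mu]_s f (t, s))%E.
  rewrite integral_mkcond; apply: eq_integral => t _.
  under eq_integral do rewrite S1 EFinM.
  rewrite ge0_integralZl_EFin//; last first.
    exact/measurable_EFinP/measurable_indic.
  rewrite integral_indic// setIT /= lebesgue_measure_itv/= patchE.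
  rewrite lte_fin; case: ifPn.
    rewrite inE/= in_itv/= andbT le_eqVlt => /predU1P[->|->].
      by rewrite ltxx subrr mul0r mule0.
    by rewrite -EFinB -EFinM mulrC.
  rewrite notin_setE/= in_itv/= andbT => /negP; rewrite -ltNge => tr.
  by rewrite ltNge (ltW tr) mule0.
transitivity (\int[mu]_s \int[mu]_t f (t, s))%E.
  exact: (fubini_tonelli (m1 := mu) (m2 := mu) f).
rewrite [RHS]integral_mkcond; apply: eq_integral => s _.
rewrite patchE; case: ifPn.
  rewrite inE/= in_itv/= andbT => rs; rewrite [RHS]integral_mkcond.
  apply: eq_integral => t _; rewrite S2// indicE patchE.
  by case: ifP => _; rewrite ?mulr1 ?mulr0.
rewrite notin_setE/= in_itv/= andbT => /negP; rewrite -ltNge => sr.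
rewrite integral0_eq// => t _; rewrite S1 indicE memNset ?mulr0//=.
by rewrite in_itv/= leNgt sr.
Qed.

(** The tail is the integral over sections of a nonnegative measurable function on the plane, so
    Tonelli's theorem gives measurability. *)
Lemma measurable_tail (z : R -> R) : measurable_fun setT z ->
  (forall t, 0 <= z t) ->
  measurable_fun setT (fun s : R => \int[mu]_(t in `[s, +oo[) (z t)%:E)%E.
Proof.
move=> mz z0; pose S := [set v : R * R | v.2 <= v.1].
have mS : measurable S.
  rewrite -[X in measurable X]setTI.
  exact: (measurable_fun_ler (f := @snd R R) (g := @fst R R)).
pose f v : \bar R := (z v.1 * \1_S v)%:E.
have mf : measurable_fun setT f.
  apply/measurable_EFinP; apply: measurable_funM; last exact: measurable_indic.
  exact: measurableT_comp.
have f0 v : (0 <= f v)%E by rewrite lee_fin mulr_ge0// indicE.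
have := measurable_fun_fubini_tonelli_G (m1 := mu) f mf f0.
congr (measurable_fun _ _); apply/funext => s.
rewrite /fubini_G [RHS]integral_mkcond; apply: eq_integral => t _.
rewrite /f indicE patchE (_ : ((t, s) \in S) = (t \in `[s, +oo[%classic)).
  by case: ifP => _; rewrite ?mulr1 ?mulr0.
by apply/idP/idP; rewrite !inE /S/= in_itv/= andbT.
Qed.

Variables (c : R) (z : R -> R).
Hypothesis zc : bounded_rate c z.

Let z_ge0 t : 0 <= z t. Proof. by have [_ /(_ t)/andP[]] := zc. Qed.

Lemma tail_ge s t p : 0 <= s -> work z t = p ->
  ((Num.max 0 (p - work z s))%:E <= \int[mu]_(u in `[s, +oo[) (z u)%:E)%E.
Proof.
move=> s0 <-; have tail0 : (0 <= \int[mu]_(u in `[s, +oo[) (z u)%:E)%E.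
  by apply: integral_ge0 => u _; rewrite lee_fin.
have [st|/ltW ts] := leP s t; last first.
  rewrite (_ : Num.max 0 _ = 0)//; apply/max_idPl.
  by rewrite subr_le0; exact: work_homo zc ts.
rewrite (_ : Num.max 0 _ = work z t - work z s); last first.
  by apply/max_idPr; rewrite subr_ge0; exact: work_homo zc st.
rewrite (workB zc)// -(integral_co_fin _ _ zc).
apply: ge0_subset_integral => //.
- by apply: measurable_funTS; apply/measurable_EFinP; exact: zc.1.
- by move=> u _; rewrite lee_fin.
- by move=> u /=; rewrite !in_itv/= => /andP[->].
Qed.

(** The converse of [tail_ge] holds once the rate vanishes from [t] on. This is the case for the
    greedy schedule, while the adversary may go on processing a completed job. *)
Lemma tail_le s t p : 0 <= s -> work z t = p -> (forall u, t <= u -> z u = 0) ->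
  (\int[mu]_(u in `[s, +oo[) (z u)%:E <= (Num.max 0 (p - work z s))%:E)%E.
Proof.
(* Nothing is processed after [v], so the unbounded integral reduces to a difference of work. *)
move=> s0 <- zt; pose v := Num.max s t.
have sv : s <= v by rewrite le_max lexx.
have -> : (\int[mu]_(u in `[s, +oo[) (z u)%:E =
           \int[mu]_(u in `[s, v[) (z u)%:E)%E.
  rewrite integral_mkcond [RHS]integral_mkcond; apply: eq_integral => u _.
  rewrite !patchE; case: ifPn => us; case: ifPn => uv //.
    move: us uv; rewrite inE notin_setE/= !in_itv/= andbT => -> /negP.
    by rewrite -leNgt /v ge_max => /andP[_ /zt ->].
  move: us uv; rewrite notin_setE inE/= !in_itv/= andbT => nsu /andP[su _].
  by case: nsu.
rewrite (integral_co_fin _ _ zc) -(workB zc)// lee_fin le_max; apply/orP; right.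
rewrite lerD2r /v; case: (leP s t) => // ts.
have [t0|/ltW t0] := leP 0 t.
  by rewrite (work_eq zc t0 (ltW ts))// => u /andP[/zt].
rewrite (work_le0 _ t0) (work_eq zc (lexx _) s0) ?(work_le0 _ (lexx _))//.
by move=> u /andP[u0 _]; apply: zt; exact: le_trans u0.
Qed.

End TimeIntegrals.

Section Costs.
Context {R : realType} {n : nat} (J : jobs R n).
Notation mu := (@lebesgue_measure R).
Implicit Types (x y : schedule R n) (j : 'I_n).
Notation F x j := (work (x j)).
Local Open Scope classical_set_scope.

(* Truncated at 0 because a feasible schedule may go on processing a completed
   job. *)
Definition residual x j t : R :=
  if release J j <= t then Num.max 0 (ptime J j - F x j t) else 0.

Lemma density_gt0 j : 0 < density J j.
Proof. by rewrite divr_gt0// ?weight_gt0// ptime_gt0. Qed.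

Lemma residual_ge0 x j t : 0 <= residual x j t.
Proof. by rewrite /residual; case: ifP => // _; rewrite le_max lexx. Qed.

Lemma measurable_residual c x j : rate_bounded J c x ->
  measurable_fun setT (residual x j).
Proof.
move=> xc; have -> : residual x j =
    fun t => \1_(`[release J j, +oo[) t * Num.max 0 (ptime J j - F x j t).
  apply/funext => t; rewrite /residual indicE.
  case: ifPn => rt; first by rewrite mem_set ?mul1r//= in_itv/= rt.
  by rewrite memNset ?mul0r//= in_itv/= andbT; exact/negP.
apply: measurable_funM; first exact: measurable_indic.
apply: (measurable_maxr (f := cst 0)) => //.
apply: measurable_funB => //; apply: nondecreasing_measurable => // s t.
exact: work_homo (xc.1 j).
Qed.

Lemma integral_residual_sum c x : rate_bounded J c x ->
  (\int[mu]_t (\sum_j density J j * residual x j t)%:E =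
   \sum_j (density J j)%:E *
     \int[mu]_(t in `[release J j, +oo[) (residual x j t)%:E)%E.
Proof.
move=> xc; under eq_integral do rewrite -sumEFin.
have mq j : measurable_fun setT (residual x j) := measurable_residual j xc.
rewrite ge0_integral_sum//; first last.
- by move=> j t _; rewrite lee_fin mulr_ge0// ?residual_ge0// ltW// density_gt0.
- by move=> j; apply/measurable_EFinP; apply: measurable_funM => //; exact: mq.
apply: eq_bigr => j _; under eq_integral do rewrite EFinM.
rewrite ge0_integralZl_EFin//; first last.
- by rewrite ltW// density_gt0.
- by apply/measurable_EFinP; exact: mq.
- by move=> t _; rewrite lee_fin residual_ge0.
congr (_ * _)%E; rewrite [RHS]integral_mkcond; apply: eq_integral => t _.
rewrite patchE /residual; case: ifPn => rt.
  by rewrite mem_set//= in_itv/= rt.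
by rewrite memNset//= in_itv/= andbT; exact/negP.
Qed.

Lemma residual_le_fractional c y : rate_bounded J c y ->
  (forall j, completion J y j < +oo)%E ->
  (\int[mu]_t (\sum_j density J j * residual y j t)%:E <=
   fractional_flow_time J y)%E.
Proof.
move=> yc Cy; rewrite (integral_residual_sum yc) /fractional_flow_time.
apply: lee_sum => j _; rewrite lee_wpmul2l// ?lee_fin ?(ltW (density_gt0 _))//.
have [mz z0] := yc.1 j.
have y0 t : 0 <= y j t by case/andP: (z0 t).
rewrite integral_tail//.
have [t [_ _ Ft]] := completion_lt_ex yc (Cy j).
apply: ge0_le_integral => //.
- by move=> s _; rewrite lee_fin residual_ge0.
- by apply/measurable_EFinP/measurable_funTS; exact: measurable_residual yc.
- by apply: measurable_funTS; exact: measurable_tail.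
- move=> s /=; rewrite in_itv/= andbT => rs; rewrite /residual rs.
  by apply: tail_ge Ft; [exact: yc.1 | exact: le_trans (release_ge0 J j) rs].
Qed.

(** This direction is for the greedy schedule, which stops at completion; [residual_le_fractional]
    is for the adversary. *)
Lemma fractional_le_residual c x : rate_bounded J c x ->
  (forall j, exists2 t, F x j t = ptime J j & forall u, t <= u -> x j u = 0) ->
  (fractional_flow_time J x <=
   \int[mu]_t (\sum_j density J j * residual x j t)%:E)%E.
Proof.
move=> xc xdone; rewrite (integral_residual_sum xc) /fractional_flow_time.
apply: lee_sum => j _; rewrite lee_wpmul2l// ?lee_fin ?(ltW (density_gt0 _))//.
have [mz z0] := xc.1 j.
have x0 t : 0 <= x j t by case/andP: (z0 t).
rewrite integral_tail//.
have [t Ft xt] := xdone j.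
apply: ge0_le_integral => //.
- by move=> s _; apply: integral_ge0 => u _; rewrite lee_fin.
- by apply: measurable_funTS; exact: measurable_tail.
- by apply/measurable_EFinP/measurable_funTS; exact: measurable_residual xc.
- move=> s /=; rewrite in_itv/= andbT => rs; rewrite /residual rs.
  apply: (tail_le (xc.1 j)) Ft xt; exact: le_trans (release_ge0 J j) rs.
Qed.

(** The residual of a job is at most [ptime J j] until its completion and 0 afterwards, and density
    times [ptime J j] is the weight. *)
Lemma residual_le_integral c y : rate_bounded J c y ->
  (forall j, completion J y j < +oo)%E ->
  (\int[mu]_t (\sum_j density J j * residual y j t)%:E <=
   integral_flow_time J y)%E.
Proof.
move=> yc Cy; rewrite (integral_residual_sum yc) /integral_flow_time.
apply: lee_sum => j _; have [C rC CE] := completion_fin (Cy j).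
have p0 := ptime_gt0 J j.
have FC := work_completion yc CE.
rewrite CE -EFinB.
have -> : (weight J j)%:E = ((density J j)%:E * (ptime J j)%:E)%E.
  by rewrite -EFinM divfK// gt_eqF.
rewrite -muleA lee_wpmul2l// ?lee_fin ?(ltW (density_gt0 _))//.
rewrite (@le_trans _ _ (\int[mu]_(t in `[release J j, +oo[)
    ((ptime J j)%:E * (\1_(`[release J j, C[) t)%:E))%E)//.
  apply: ge0_le_integral => //.
  - by move=> s _; rewrite lee_fin residual_ge0.
  - by apply/measurable_EFinP/measurable_funTS; exact: measurable_residual yc.
  - exact/measurable_EFinP/measurable_funTS/measurable_funM.
  move=> s /=; rewrite in_itv/= andbT => rs; rewrite /residual rs lee_fin.
  rewrite indicE; have [sC|Cs] := ltP s C.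
    rewrite mem_set/= ?in_itv/= ?rs// mulr1 ge_max (ltW p0)/= gerBl.
    by apply: Rintegral_ge0 => u _; have [_ /(_ u)/andP[]] := yc.1 j.
  rewrite memNset/= ?in_itv/= ?rs ?ltNge ?Cs// mulr0 ge_max lexx/= subr_le0 -FC.
  exact: work_homo (yc.1 j) Cs.
rewrite ge0_integralZl_EFin//; first last.
- exact: ltW.
- by apply/measurable_EFinP/measurable_funTS/measurable_indic.
rewrite integral_indic//= lee_wpmul2l// ?lee_fin ?(ltW p0)//.
apply: (@le_trans _ _ (mu `[release J j, C[)).
  by rewrite le_measure// inE//; exact: measurableI.
rewrite /= lebesgue_measure_itv/= lte_fin; case: ifP => _.
  by rewrite EFinB.
by rewrite lee_fin subr_ge0.
Qed.

Lemma indic_pending x j C : completion J x j = C%:E ->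
  (fun t => (`[< pending J x j t >])%:R : R) = \1_(`[release J j, C[).
Proof.
move=> CE; apply/funext => t; rewrite indicE; congr (_%:R); congr nat_of_bool.
apply/asboolP/idP; rewrite inE/= in_itv/= /pending CE lte_fin.
  by move=> [-> ->].
by move=> /andP[].
Qed.

Lemma measurable_pending x j : (completion J x j < +oo)%E ->
  measurable_fun setT (fun t => (`[< pending J x j t >])%:R : R).
Proof.
move=> /completion_fin[C _ CE]; rewrite (indic_pending CE).
exact: measurable_indic.
Qed.

(** Each job is pending exactly from its release up to, but excluding, its completion time, an
    interval whose length is its flow time. *)
Lemma integral_flow_timeE x : (forall j, completion J x j < +oo)%E ->
  integral_flow_time J x =
  (\int[mu]_t (\sum_j weight J j * (`[< pending J x j t >])%:R)%:E)%E.
Proof.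
move=> Cx; under eq_integral do rewrite -sumEFin.
rewrite ge0_integral_sum//; first last.
- by move=> j t _; rewrite lee_fin mulr_ge0// ltW// weight_gt0.
- move=> j; apply/measurable_EFinP; apply: measurable_funM => //.
  exact: measurable_pending.
apply: eq_bigr => j _; under eq_integral do rewrite EFinM.
rewrite ge0_integralZl_EFin//; first last.
- by rewrite ltW// weight_gt0.
- by apply/measurable_EFinP; exact: measurable_pending.
congr (_ * _)%E; have [C rC CE] := completion_fin (Cx j).
rewrite CE.
transitivity (\int[mu]_t (\1_(`[release J j, C[) t)%:E)%E; last first.
  by apply: eq_integral => t _; rewrite -(indic_pending CE).
rewrite integral_indic//= setIT lebesgue_measure_itv/= lte_fin -EFinB.
case: ltP => // Cr; congr EFin; apply/eqP.
by rewrite subr_eq0 eq_le Cr rC.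
Qed.

End Costs.

(** * Comparison with the adversary *)

Section Competitive.
Context {R : realType} {m n : nat}.
Variables (B : 'M[R]_(m.+1, n)) (J : jobs R n).
Hypothesis B_gt0 : forall i j, 0 < B i j.
Variables (x y : schedule R n) (c : R).
Hypotheses (xg : greedy B J x) (yf : feasible B J c y).
Notation F x j := (work (x j)).
Notation kappa := (priority B J).

Lemma densityE j : density J j = kappa j * colmin B j.
Proof. by rewrite /priority divfK// gt_eqF// colmin_gt0. Qed.

Lemma priority_ge0 j : 0 <= kappa j.
Proof. by rewrite divr_ge0// ltW ?density_gt0 ?colmin_gt0. Qed.

(** The first constraint alone bounds the rate of [j] by [c / B ord0 j]; summing over the jobs makes
    the bound uniform. *)
Lemma feasible_rate_bounded : rate_bounded J (\sum_j c / B ord0 j) y.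
Proof.
have [my y0 yr ycap _] := yf; split => // j; split => // t; rewrite y0/=.
have c0 : 0 <= c.
  apply: le_trans (ycap ord0 t); apply: sumr_ge0 => k _.
  by rewrite mulr_ge0// ltW.
rewrite (bigD1 j)//= ler_wpDr//.
  by apply: sumr_ge0 => k _; rewrite divr_ge0// ltW.
rewrite ler_pdivlMr// mulrC (le_trans _ (ycap ord0 t))// (bigD1 j)//= lerDl.
by apply: sumr_ge0 => k _; rewrite mulr_ge0// ltW.
Qed.

Lemma feasible_colmin t : \sum_j colmin B j * y j t <= c.
Proof.
have [_ y0 _ ycap _] := yf; apply: le_trans (ycap ord0 t).
by apply: ler_sum => j _; rewrite ler_wpM2r// colmin_le.
Qed.

Let xc := greedy_rate_bounded B_gt0 xg.
Let yc := feasible_rate_bounded.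
Let y0 j t : 0 <= y j t. Proof. by have [_ + _ _ _] := yf; apply. Qed.

Let b_ge0 j : 0 <= colmin B j. Proof. by rewrite ltW// colmin_gt0. Qed.

Lemma residual_ge j t : release J j <= t ->
  ptime J j - F y j t <= residual J y j t.
Proof. by move=> rt; rewrite /residual rt le_max lexx orbT. Qed.

Lemma sum_residual_ge theta (D : {set 'I_n}) t :
  (forall j, j \in D -> theta <= kappa j /\ release J j <= t) ->
  \sum_(j in D) colmin B j * (ptime J j - F y j t) <=
  \sum_(j | theta <= kappa j) colmin B j * residual J y j t.
Proof.
move=> DS; rewrite big_mkcond [leRHS]big_mkcond; apply: ler_sum => j _.
case: ifP => [/DS[-> rj]|_].
  by rewrite ler_wpM2l// residual_ge.
by case: ifP => // _; rewrite mulr_ge0// residual_ge0.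
Qed.

Lemma greedy_residual t : (forall j, c <= colmin B j / colmax B j) ->
  \sum_j density J j * residual J x j t <=
  \sum_j density J j * residual J y j t.
Proof.
move=> cB; under eq_bigr do rewrite densityE -mulrA.
under [leRHS]eq_bigr do rewrite densityE -mulrA.
apply: le_sum_upper_sets; first exact: priority_ge0.
move=> theta.
have [|j|D [DS nD DF]] :=
  greedy_domination B_gt0 xg (e := 0) theta t yc y0 feasible_colmin.
- by rewrite addr0.
- by rewrite addr0 mul1r.
apply: le_trans (sum_residual_ge DS).
rewrite addr0 mul1r in DF.
(* Above [theta] the greedy residual lives on [D], as the other released jobs are complete. On [D]
   the truncation at 0 has no effect, since the greedy schedule never exceeds [ptime J j]. *)
rewrite [leLHS](_ : _ = \sum_(j in D) colmin B j * (ptime J j - F x j t)).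
  under eq_bigr do rewrite mulrBr; under [leRHS]eq_bigr do rewrite mulrBr.
  by rewrite !sumrB lerD2l lerN2.
rewrite big_mkcond [RHS]big_mkcond; apply: eq_bigr => j _.
rewrite /residual; case: ifPn => [thj|nth]; last first.
  by case: ifPn => // /DS[]; rewrite (negbTE nth).
case: ifPn => [rj|/negbTE rj]; last first.
  by rewrite mulr0; case: ifP => // /DS[]; rewrite rj.
case: ifPn => [jD|jD].
  by congr (_ * _); apply/max_idPr; rewrite subr_ge0 (greedy_work_le B_gt0 xg).
by rewrite (greedy_work_done B_gt0 xg rj) ?subrr ?maxxx ?mulr0//; exact: nD.
Qed.

Lemma greedy_pending_weight (e t : R) : 0 < e ->
  (forall j, (1 + e) * c <= colmin B j / colmax B j) ->
  \sum_j weight J j * (`[< pending J x j t >])%:R <=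
  (1 + e) / e * \sum_j density J j * residual J y j t.
Proof.
move=> e0 cB; have e1 : 0 < 1 + e by rewrite addr_gt0.
(* A pending job is charged its whole scaled volume [colmin B j * ptime J j], not just what remains
   of it. *)
have wE j : weight J j = kappa j * (colmin B j * ptime J j).
  by rewrite mulrA -densityE divfK// gt_eqF// ptime_gt0.
set K := (1 + e) / e.
rewrite mulr_sumr; under eq_bigr do rewrite wE -mulrA.
under [leRHS]eq_bigr do rewrite densityE -mulrA (mulrCA K).
apply: le_sum_upper_sets; first exact: priority_ge0.
move=> theta; rewrite -mulr_sumr.
have [|j|D [DS nD DF]] :=
  greedy_domination B_gt0 xg (e := e) theta t yc y0 feasible_colmin.
- exact: ltW.
- exact: cB.
pose N := \sum_(j in D) colmin B j * ptime J j.
have pendN : \sum_(j | theta <= kappa j)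
    colmin B j * ptime J j * (`[< pending J x j t >])%:R <= N.
  rewrite big_mkcond /N [leRHS]big_mkcond; apply: ler_sum => j _.
  have bp0 : 0 <= colmin B j * ptime J j by rewrite mulr_ge0// ltW// ptime_gt0.
  case: (boolP (j \in D)) => jD.
    by rewrite (DS j jD).1 ler_piMr// lern1 leq_b1.
  case: ifPn => // thj; rewrite (_ : `[< _ >] = false) ?mulr0//.
  by apply/asboolP => pj; exact: (nD j thj pj.1 jD).
apply: (le_trans pendN).
have xN : \sum_(j in D) colmin B j * F x j t <= N.
  by apply: ler_sum => j _; rewrite ler_wpM2l// (greedy_work_le B_gt0 xg).
pose W := \sum_(j in D) colmin B j * F y j t.
pose V := \sum_(j | theta <= kappa j) colmin B j * residual J y j t.
have NV : N - W <= V.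
  apply: le_trans (sum_residual_ge DS); rewrite /N -sumrB.
  by apply: ler_sum => j _; rewrite mulrBr.
rewrite /K mulrAC ler_pdivlMr// -/V.
(* Domination gives [(1 + e) * W <= N], hence [e * N <= (1 + e) * (N - W)], which is at most
   [(1 + e) * V]. *)
have : (1 + e) * (N - W) <= (1 + e) * V by rewrite ler_wpM2l// ltW.
move: DF xN; rewrite -/W; lra.
Qed.

End Competitive.

(** * Integration of the pointwise bounds over time *)

Section CostComparison.
Context {R : realType} {m n : nat}.
Variables (B : 'M[R]_(m.+1, n)) (J : jobs R n).
Hypothesis B_gt0 : forall i j, 0 < B i j.
Variable x : schedule R n.
Hypothesis xg : greedy B J x.
Notation mu := (@lebesgue_measure R).

Lemma greedy_fractional (c : R) y : feasible B J c y ->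
  (forall j, c <= colmin B j / colmax B j) ->
  (fractional_flow_time J x <= fractional_flow_time J y)%E.
Proof.
move=> yf cB; have xc := greedy_rate_bounded B_gt0 xg.
have yc := feasible_rate_bounded B_gt0 yf.
have [_ _ _ _ yC] := yf.
apply: le_trans (residual_le_fractional yc yC).
apply: le_trans (fractional_le_residual xc _) _.
  move=> j; have [C rC CE] := completion_fin (greedy_completes B_gt0 xg j).
  exists C; first exact: work_completion xc CE.
  move=> u Cu; apply: (greedy_idle xg) => -[_]; rewrite CE lte_fin.
  by rewrite ltNge Cu.
apply: ge0_le_integral => //.
- move=> t _; rewrite lee_fin sumr_ge0// => j _.
  by rewrite mulr_ge0 ?residual_ge0// ltW// density_gt0.
- apply/measurable_EFinP; apply: measurable_sum => j.
  by apply: measurable_funM => //; exact: measurable_residual xc.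
- apply/measurable_EFinP; apply: measurable_sum => j.
  by apply: measurable_funM => //; exact: measurable_residual yc.
- by move=> t _; rewrite lee_fin; exact: (greedy_residual B_gt0 xg yf).
Qed.

Lemma greedy_integral (c : R) y (e : R) : feasible B J c y -> 0 < e ->
  (forall j, (1 + e) * c <= colmin B j / colmax B j) ->
  (integral_flow_time J x <= ((1 + e) / e)%:E * integral_flow_time J y)%E.
Proof.
move=> yf e0 cB; have xc := greedy_rate_bounded B_gt0 xg.
have yc := feasible_rate_bounded B_gt0 yf.
have [_ _ _ _ yC] := yf.
have k0 : 0 <= (1 + e) / e by rewrite divr_ge0 ?addr_ge0// ltW.
have mV : measurable_fun setT (fun t => \sum_j density J j * residual J y j t).
  apply: measurable_sum => j.
  by apply: measurable_funM => //; exact: measurable_residual yc.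
have V0 t : 0 <= \sum_j density J j * residual J y j t.
  by apply: sumr_ge0 => j _; rewrite mulr_ge0 ?residual_ge0// ltW// density_gt0.
apply: (@le_trans _ _ (((1 + e) / e)%:E *
    \int[mu]_t (\sum_j density J j * residual J y j t)%:E)%E); last first.
  by rewrite lee_wpmul2l// ?lee_fin//; exact: residual_le_integral yc yC.
rewrite integral_flow_timeE; last exact: greedy_completes.
rewrite -ge0_integralZl_EFin//; last 2 first.
- by move=> t _; rewrite lee_fin.
- exact/measurable_EFinP.
under [leRHS]eq_integral do rewrite -EFinM.
apply: ge0_le_integral => //.
- move=> t _; rewrite lee_fin sumr_ge0// => j _.
  by rewrite mulr_ge0 ?ler0n// ltW// weight_gt0.
- apply/measurable_EFinP; apply: measurable_sum => j.
  apply: measurable_funM => //; apply: measurable_pending.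
  exact: greedy_completes xg j.
- apply/measurable_EFinP; exact: (measurable_funM (f := cst ((1 + e) / e))) mV.
- by move=> t _; rewrite lee_fin; exact: (greedy_pending_weight B_gt0 xg yf).
Qed.

End CostComparison.

(** Turns the adversary's capacity, the inverse of a maximum over jobs, into a bound for each single
    job. The default 0 is harmless because the positive value at [j] enters the maximum. *)
Lemma inv_bigmax_le (R : realType) (I : finType) (a : I -> R) j :
  (forall i, 0 < a i) -> (\big[Num.max/0]_i a i)^-1 <= (a j)^-1.
Proof.
move=> a0; have aj : a j <= \big[Num.max/0]_i a i by exact: le_bigmax.
by rewrite lef_pV2 ?posrE//; exact: lt_le_trans aj.
Qed.

Theorem theorem12 (R : realType) (m n : nat) (B : 'M[R]_(m.+1, n))
    (B_gt0 : forall i j, 0 < B i j) :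
  speed_competitive B (greedy B) (@fractional_flow_time R n)
    (\big[Num.max/0]_(j < n) (colmax B j / colmin B j)) 1
  /\
  forall eps : R, 0 < eps ->
    speed_competitive B (greedy B) (@integral_flow_time R n)
      (\big[Num.max/0]_(j < n) ((1 + eps) * colmax B j / colmin B j))
      ((1 + eps) / eps).
Proof.
have b0 j : 0 < colmin B j := colmin_gt0 B_gt0 j.
have B0 j : 0 < colmax B j := colmax_gt0 B_gt0 j.
split=> [J|eps eps0 J]; split; try exact: greedy_exists.
  move=> x xg; split; first exact: greedy_feasible.
  rewrite mul1e; apply: le_ereal_inf_tmp => _ [y yf <-].
  apply: (greedy_fractional B_gt0 xg yf) => // j.
  apply: le_trans (inv_bigmax_le _ _) _; first by move=> i; exact: divr_gt0.
  by rewrite invf_div.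
move=> x xg; split; first exact: greedy_feasible.
have e1 : 0 < 1 + eps by rewrite addr_gt0.
(* Dividing by the positive ratio isolates the infimum, so that it suffices to treat one adversary
   schedule at a time. *)
rewrite -lee_pdivrMl ?divr_gt0//; apply: le_ereal_inf_tmp => _ [y yf <-].
rewrite lee_pdivrMl ?divr_gt0//; apply: (greedy_integral B_gt0 xg yf) => // j.
(* The factor [1 + eps] in the speed cancels the one demanded of the greedy rates, leaving
   [colmin B j / colmax B j]. *)
apply: (@le_trans _ _ ((1 + eps) * ((1 + eps) * colmax B j / colmin B j)^-1)).
  rewrite ler_pM2l//; apply: (inv_bigmax_le j) => i.
  by rewrite divr_gt0// mulr_gt0.
by rewrite -mulrA invfM mulrA mulfV ?gt_eqF// mul1r invf_div.
Qed.
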